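(* Let $H\in(0,1)$ and let $W^H(n)$, $n\ge 0$, be the standard discrete-time fractional Gaussian noise (fGn) with Hurst exponent $H$, $$W^H(n)=\sum_{i=0}^{n}h_{n-i}^{H-\frac12}\,W(i)\quad\text{if }H\neq\tfrac12,\qquad W^H(n)=W(n)\quad\text{if }H=\tfrac12,$$ where $W(n)\sim N(0,1)$ is standard Gaussian white noise and $h_{n}^{H-\frac12}=\dfrac{\Gamma(n+H-\frac12)}{\Gamma(H-\frac12)\,\Gamma(n+1)}$. Suppose that the sequence $W^H(n)$ is bounded within $[-b,b]$ in a finite time horizon $[0,t]$, that an $M$-level uniform quantizer in $[-b,b]$ is applied to it, and put $\Delta=\frac{2b}{M-1}$. Then, under the assumption of high resolution (the sample rate and the resolution of the quantizer are high enough), the normalized quantization error $e(n)$ of $W^H$ with this uniform quantizer is asymptotically uniformly distributed in $[-\frac12,\frac12]$, i.e. the distribution of $e(n)$ converges to the uniform distribution on $[-\frac12,\frac12]$ as $n\to\infty$.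
   Context: $\Gamma$ is the Gamma function, and $\langle x\rangle=x \bmod 1$ is the fractional part of a real number $x$. In the setting above (signal $S(n)$ bounded within $[-b,b]$ in a finite time horizon, $M$-level uniform quantizer in $[-b,b]$, $\Delta=\frac{2b}{M-1}$, sample rate and quantizer resolution assumed high enough), the normalized quantization noise $e(n)$ of $S$ is represented as the normalized quantization noise of the sigma-delta modulator for $S$: $$e(n)=\frac12-\Big\langle\sum_{i=0}^{n}\Big(\frac{S(i)}{\Delta}+\frac12\Big)\Big\rangle .$$ Here $S=W^H$. ''High resolution'' is used informally, in the sense just described; no quantitative condition on $M$, $b$ or $\Delta$ is specified. *)

(* Defs.v *)
From HB Require Import structures.
From mathcomp Require Import all_boot all_order all_algebra.
From mathcomp Require Import finmap.
From mathcomp Require Import all_classical all_reals all_analysis.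
From mathcomp Require Import measurable_realfun.

Set Implicit Arguments.
Unset Strict Implicit.
Unset Printing Implicit Defensive.

Import Order.TTheory GRing.Theory Num.Theory.
Import numFieldNormedType.Exports.

Local Open Scope classical_set_scope.
Local Open Scope ring_scope.

Definition euler_integral (R : realType) (x : R) : R :=
  \int[lebesgue_measure]_(t in `]0%R, +oo[) (t `^ (x - 1) * expR (- t)).

(* The Gamma function on the real line. The arguments H - 1/2 with H < 1/2 are
   negative, where Euler's integral diverges; there Gamma is continued by
     Gamma x = Gamma (x + n) / (x (x + 1) ... (x + n - 1)),
   n being the least natural number with 0 < x + n. At the poles 0, -1, -2, ... the
   value is 0, by the convention on division. *)
Definition Gamma (R : realType) (x : R) : R :=
  let n := if 0 < x then 0%N else (Num.truncn (- x)).+1 in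
  euler_integral (x + n%:R) / \prod_(k < n) (x + k%:R).

Definition fgn_coef (R : realType) (a : R) (n : nat) : R :=
  Gamma (n%:R + a) / (Gamma a * Gamma (n%:R + 1)).

Definition frac (R : realType) (x : R) : R := x - (Num.floor x)%:~R.

Lemma measurable_frac (R : realType) : measurable_fun [set: R] (@frac R).
Proof.
apply: measurable_funB => //.
apply: nondecreasing_measurable => // x y xy.
by rewrite ler_int; apply: Num.Theory.le_floor.
Qed.

Section random_variables.
Context (d : measure_display) (T : measurableType d) (R : realType).
Implicit Types W S : nat -> {mfun T >-> R}.

Definition mutually_independent (P : probability T R) W :=
  forall (J : {fset nat}) (A : nat -> set R),
    (forall i, measurable (A i)) ->
    P (\bigcap_(i in [set` J]) (W i @^-1` A i)) =
    (\prod_(i <- J) P (W i @^-1` A i))%E.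

(* The laws are compared on measurable sets only: outside of them a measure is
   an arbitrary set function. *)
Definition gaussian_white_noise (P : probability T R) W :=
  mutually_independent P W /\
  forall (n : nat) (A : set R), measurable A ->
    distribution P (W n) A = normal_prob 0 1 A.

Definition fgn (H : R) W (n : nat) : T -> R := fun w =>
  if H == 2^-1 then W n w
  else \sum_(i < n.+1) fgn_coef (H - 2^-1) (n - i)%N * W i w.

Lemma measurable_fgn H W n : measurable_fun [set: T] (fgn H W n).
Proof.
rewrite /fgn; case: (H == 2^-1) => //.
by apply: measurable_sum => i; apply: measurable_funM.
Qed.

HB.instance Definition _ H W n :=
  isMeasurableFun.Build _ _ _ _ (fgn H W n) (measurable_fgn H W n).

(* The high-resolution representation of the normalized quantization noise of
   S, with quantizer step Delta, as that of the sigma-delta modulator for S. *)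
Definition quantization_noise (Delta : R) S (n : nat) : T -> R := fun w =>
  2^-1 - frac (\sum_(i < n.+1) (S i w / Delta + 2^-1)).

Lemma measurable_quantization_noise Delta S n :
  measurable_fun [set: T] (quantization_noise Delta S n).
Proof.
apply: measurable_funB => //; apply: measurableT_comp.
  exact: measurable_frac.
by apply: measurable_sum => i; apply: measurable_funD => //; apply: measurable_funM.
Qed.

HB.instance Definition _ Delta S n :=
  isMeasurableFun.Build _ _ _ _ (quantization_noise Delta S n)
    (measurable_quantization_noise Delta S n).

(* A Gaussian sequence is never almost surely bounded by a constant, so
   boundedness within [-b, b] over the horizon is an event to condition on
   rather than an almost sure property. *)
Definition bounded_on_horizon (b : R) (t : nat) S : set T :=
  [set w | forall i, (i <= t)%N -> - b <= S i w <= b].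

Lemma measurable_bounded_on_horizon b t S :
  measurable (bounded_on_horizon b t S).
Proof.
rewrite (_ : bounded_on_horizon b t S =
    \bigcap_(i in [set i | (i <= t)%N]) (S i @^-1` `[- b, b])).
  apply: bigcap_measurable; first by exists 0%N.
  by move=> i _; rewrite -[X in measurable X]setTI; exact: measurable_funP.
apply/seteqP; split => w hw i it; have := hw i it; by rewrite /= in_itv.
Qed.

(* P( . | B); the last argument of mnormalize is a default value, used only
   when P B = 0. *)
Definition conditional (P : probability T R) (B : set T) (mB : measurable B) :
    probability T R :=
  mnormalize (mrestr P mB) P.

End random_variables.

(* Convergence of the distribution functions at the continuity points of the
   limiting one. *)
Definition cvg_in_distribution (d : measure_display) (T : measurableType d)
    (R : realType) (P : probability T R) (X : nat -> {RV P >-> R})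
    (mu : probability (measurableTypeR R) R) :=
  forall x : R,
    {for x, continuous (fun y : R => fine (mu [set` `]-oo, y]]))} ->
    cdf (X n) x @[n --> \oo] --> mu [set` `]-oo, x]].

Arguments cvg_in_distribution {d T R} P X mu.

Lemma ltN_half (R : realType) : - 2^-1 < 2^-1 :> R.
Proof. by rewrite gtrN// invr_gt0. Qed.

(* Main.v *)
(* The partial sum of the noise is a moving average X_n = sum_j c_(n-j) W_j with
   c_n = prod_(k = 1 .. n) (1 + (H - 1/2) / k), by the functional equation of Gamma.
   Since c_n^2 >= 1 / (4 (n + 1)) for every H > 0, the variance of X_n diverges like
   the harmonic series at least. The event B of boundedness on [0, t] and the part of
   X_n carried by W_0, ..., W_t belong to the past at time t + 1, while the rest of
   X_n is a centred Gaussian, independent of this past, whose standard deviation s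
   still diverges. Shifting N(m, s) by at most 1 changes it in total variation by an
   amount vanishing with 1 / s, and the average over shifts in [0, 1[ of the
   probability that <x> >= th is exactly 1 - th. Hence <X_n / Delta + constant> is
   asymptotically uniform, conditionally on the past and uniformly in it. *)

Require Import Defs.
From HB Require Import structures.
From mathcomp Require Import all_boot all_order all_algebra.
From mathcomp Require Import finmap.
From mathcomp Require Import all_classical all_reals all_analysis.
From mathcomp Require Import measurable_realfun.
From mathcomp Require Import ring lra zify.
Set Implicit Arguments.
Unset Strict Implicit.
Unset Printing Implicit Defensive.
Import Order.TTheory GRing.Theory Num.Theory.
Import numFieldNormedType.Exports.
Local Open Scope classical_set_scope.
Local Open Scope ring_scope.

(* [frac] alone denotes the fractions of MathComp here. *)
Local Notation frac := Defs.frac.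

(** * The Gamma function *)

Section gamma.
Context (R : realType).
Implicit Types (p t x : R).
Local Notation mu := (@lebesgue_measure R).

Definition gamma_fun x t : R := t `^ (x - 1) * expR (- t).

(** Euler's integral with values in the extended reals, where monotone limits need no prior
    finiteness. [euler_integral] is its [fine], so identities pass to it once finiteness is
    known. *)
Definition gamma_integral x : \bar R :=
  (\int[mu]_(t in `]0%R, +oo[) (gamma_fun x t)%:E)%E.

Lemma gamma_fun_ge0 x t : 0 <= gamma_fun x t.
Proof. by rewrite mulr_ge0 ?powR_ge0 ?expR_ge0. Qed.

Lemma gamma_integral_ge0 x : (0 <= gamma_integral x)%E.
Proof. by apply: integral_ge0 => t _; rewrite lee_fin gamma_fun_ge0. Qed.

Lemma measurable_gamma_fun x : measurable_fun setT (gamma_fun x).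
Proof.
apply: measurable_funM; first exact: measurable_powR.
by apply: measurableT_comp => //; exact: measurable_expR.
Qed.

(* [ln (t / q) <= t / q - 1] with [q = 2 p + 2], hence [p ln t <= p ln q + t / 2]. *)
Lemma powR_expRN_le p : 0 <= p ->
  exists2 C, 0 <= C & forall t, 0 < t -> t `^ p * expR (- t) <= C * expR (- (t / 2)).
Proof.
move=> p0; pose q := 2 * p + 2; have q0 : 0 < q by rewrite /q; lra.
exists (expR (p * ln q)); first exact: expR_ge0.
move=> t t0; rewrite /powR gt_eqF// -!expRD ler_expR.
have tq0 : 0 < t / q by rewrite divr_gt0.
have lntq : ln (t / q) <= t / q - 1.
  by rewrite -[X in ln X](_ : 1 + (t / q - 1) = _); [apply: le_ln1Dx; lra|lra].
rewrite ln_div ?posrE// in lntq.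
have plnt : p * (ln t - ln q) <= p * (t / q) by rewrite ler_wpM2l//; lra.
have ptq : p * (t / q) <= t / 2.
  rewrite mulrCA; apply: ler_wpM2l; first exact: ltW.
  by rewrite ler_pdivrMr// /q; lra.
lra.
Qed.

(** The exponential law of rate 1/2 has total mass 1 and density half the integrand. *)
Lemma integral_expRN_half :
  (\int[mu]_(t in `]0%R, +oo[) (expR (- (t / 2)))%:E = 2%:E)%E.
Proof.
have := @integral_exponential_pdf R 2^-1; rewrite invr_gt0 => /(_ ltac:(lra)) int1.
have mE : measurable_fun setT (fun t : R => expR (- (t / 2))).
  apply: measurableT_comp; first exact: measurable_expR.
  by apply: measurableT_comp => //; exact: measurable_funM.
rewrite integral_itv_obnd_cbnd; last first.
  by apply/measurable_EFinP; exact: measurable_funTS.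
rewrite -[RHS]mule1 -[X in (_ * X)%E]int1 -ge0_integralZl//; last 2 first.
- by apply/measurable_EFinP; exact: measurable_exponential_pdf.
- by move=> t _; rewrite lee_fin exponential_pdf_ge0// ltW// invr_gt0.
rewrite [LHS]integral_mkcond; apply: eq_integral => t _.
rewrite patchE /exponential_pdf patchE.
case: ifPn => _; last by rewrite mule0.
by rewrite -EFinM mulrA divff// mul1r; congr (expR _)%:E; lra.
Qed.

(** For such [x] the exponent [x - 1] is nonnegative, so the integrand is dominated by a multiple of
    [expR (- (t / 2))] down to 0. The range below 1 is reached through the functional equation. *)
Lemma gamma_integral_fin1 x : 1 <= x -> (gamma_integral x < +oo)%E.
Proof.
move=> x1; have [|C C0 leC] := @powR_expRN_le (x - 1); first by lra.
apply: (@le_lt_trans _ _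
    (\int[mu]_(t in `]0%R, +oo[) (C * expR (- (t / 2)))%:E)%E).
  apply: ge0_le_integral => //.
  - by move=> t _; rewrite lee_fin gamma_fun_ge0.
  - by apply/measurable_EFinP; apply: measurable_funTS; exact: measurable_gamma_fun.
  - apply/measurable_EFinP; apply: measurable_funTS; apply: measurable_funM => //.
    apply: measurableT_comp; first exact: measurable_expR.
    by apply: measurableT_comp => //; exact: measurable_funM.
  - by move=> t /=; rewrite in_itv/= andbT lee_fin => /leC.
under eq_integral do rewrite EFinM.
rewrite ge0_integralZl//.
- by rewrite integral_expRN_half -EFinM ltry.
- apply/measurable_EFinP; apply: measurable_funTS.
  apply: measurableT_comp; first exact: measurable_expR.
  by apply: measurableT_comp => //; exact: measurable_funM.
Qed.

Lemma gamma_integral1 : gamma_integral 1 = 1%E.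
Proof.
have mE : measurable_fun setT (fun t : R => expR (- t)).
  by apply: measurableT_comp; first exact: measurable_expR.
rewrite /gamma_integral.
under eq_integral do rewrite /gamma_fun subrr powRr0 mul1r.
rewrite integral_itv_obnd_cbnd; last first.
  by apply/measurable_EFinP; exact: measurable_funTS.
rewrite -(@integral_exponential_pdf R 1)//.
rewrite [LHS]integral_mkcond; apply: eq_integral => t _.
by rewrite patchE /exponential_pdf patchE mul1r mulN1r; case: ifPn.
Qed.

(** On [1, 2] one has 0 <= ln t <= 1, which bounds the integrand below by a positive constant. *)
Lemma gamma_integral_gt0 x : (0 < gamma_integral x)%E.
Proof.
have le12 t : 1 <= t <= 2 -> expR (- `|x - 1| - 2) <= gamma_fun x t.
  move=> t12; rewrite /gamma_fun expRD ler_pM ?expR_ge0//; last by rewrite ler_expR; lra.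
  rewrite /powR gt_eqF; last by lra.
  have lnt0 : 0 <= ln t by apply: ln_ge0; lra.
  have lnt1 : ln t <= 1.
    rewrite -[X in ln X](_ : 1 + (t - 1) = _); last by lra.
    by apply: (le_trans (le_ln1Dx _)); lra.
  rewrite ler_expR; have xN := ler_norm (- (x - 1)); rewrite normrN in xN.
  have := normr_ge0 (x - 1); nra.
apply: (@lt_le_trans _ _
   (\int[mu]_(t in `[1%R, 2%R]) (expR (- `|x - 1| - 2))%:E)%E).
  rewrite integral_cst//= lebesgue_measure_itv/= lte_fin ifT; last by lra.
  by rewrite -EFinB -EFinM lte_fin mulr_gt0 ?expR_gt0//; lra.
apply: (@le_trans _ _ (\int[mu]_(t in `[1%R, 2%R]) (gamma_fun x t)%:E)%E).
  apply: ge0_le_integral => //.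
  by apply/measurable_EFinP; apply: measurable_funTS; exact: measurable_gamma_fun.
apply: ge0_subset_integral => //.
- by apply/measurable_EFinP; apply: measurable_funTS; exact: measurable_gamma_fun.
- by move=> t _; rewrite lee_fin gamma_fun_ge0.
- by move=> t /=; rewrite !in_itv/= andbT; lra.
Qed.

Lemma gamma_integral_by_parts x (a b : R) : 0 < x -> 0 < a -> a < b ->
  (\int[mu]_(t in `[a, b]) (gamma_fun (x + 1)%R t)%:E =
   (a `^ x * expR (- a) - b `^ x * expR (- b))%:E +
   x%:E * \int[mu]_(t in `[a, b]) (gamma_fun x t)%:E)%E.
Proof.
move=> x0 a0 ab.
pose F t := t `^ x; pose f t := x * t `^ (x - 1).
pose G t := - expR (- t); pose g t := expR (- t).
have dF t : 0 < t -> is_derive t 1 F (f t) by exact: is_derive1_powR.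
have dG t : is_derive t (1 : R) G (g t).
  by apply: is_derive_eq; rewrite /g mulrN1 opprK.
have cF t : 0 < t -> {for t, continuous F}.
  move=> /dF dFt; apply/differentiable_continuous/derivable1_diffP; exact: ex_derive.
have cG t : {for t, continuous G}.
  apply/differentiable_continuous/derivable1_diffP; exact: (@ex_derive _ _ _ _ _ _ _ (dG t)).
have cf t : 0 < t -> {for t, continuous f}.
  move=> t0; apply: continuousM; first exact: cst_continuous.
  apply/differentiable_continuous/derivable1_diffP.
  exact: (@ex_derive _ _ _ _ _ _ _ (is_derive1_powR (x - 1) t0)).
have cg t : {for t, continuous g}.
  apply: continuous_comp; [exact: (@continuousN _ R^o)|exact: continuous_expR].
have cc_gt0 t : t \in `[a, b] -> 0 < t.
  by rewrite in_itv/= => /andP[+ _]; exact: lt_le_trans.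
have oo_gt0 t : t \in `]a, b[ -> 0 < t.
  by rewrite in_itv/= => /andP[+ _]; exact: lt_trans.
have b0 : 0 < b by exact: lt_trans ab.
have := @integration_by_parts R F G f g a b ab.
have -> : (\int[mu]_(t in `[a, b]) (F t * g t)%:E =
           \int[mu]_(t in `[a, b]) (gamma_fun (x + 1)%R t)%:E)%E.
  by apply: eq_integral => t _; rewrite /gamma_fun addrK.
have -> : (\int[mu]_(t in `[a, b]) (f t * G t)%:E =
           - (x%:E * \int[mu]_(t in `[a, b]) (gamma_fun x t)%:E))%E.
  rewrite -ge0_integralZl//; last 3 first.
  - by apply/measurable_EFinP; apply: measurable_funTS; exact: measurable_gamma_fun.
  - by move=> t _; rewrite lee_fin gamma_fun_ge0.
  - by rewrite lee_fin ltW.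
  rewrite -integral_ge0N; last first.
    by move=> t _; rewrite mule_ge0 ?lee_fin ?gamma_fun_ge0// ltW.
  apply: eq_integral => t _; rewrite -EFinM -EFinN; congr EFin.
  by rewrite /f /G /gamma_fun mulrN mulrA.
rewrite oppeK => -> //.
- by congr (_%:E + _)%E; rewrite /F /G; ring.
- apply: continuous_in_subspaceT => t; rewrite inE/= => tab; exact/cf/cc_gt0.
- split.
  + by move=> t /oo_gt0 /dF dFt; exact: ex_derive.
  + by apply: cvg_at_right_filter; exact: cF.
  + by apply: cvg_at_left_filter; exact: cF.
- by move=> t /oo_gt0 /dF dFt; rewrite derive1E; exact: derive_val.
- by apply: continuous_in_subspaceT => t _; exact: cg.
- split.
  + by move=> t _; exact: (@ex_derive _ _ _ _ _ _ _ (dG t)).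
  + by apply: cvg_at_right_filter; exact: cG.
  + by apply: cvg_at_left_filter; exact: cG.
- by move=> t _; rewrite derive1E; exact: (@derive_val _ _ _ _ _ _ _ (dG t)).
Qed.

(** Monotone convergence along an exhaustion of the half-line. The right endpoint [n.+2] keeps the
    interval nondegenerate already at n = 0. *)
Lemma cvg_gamma_integral x :
  (\int[mu]_(t in `[n.+1%:R^-1%R, n.+2%:R%R]) (gamma_fun x t)%:E @[n --> \oo] -->
   gamma_integral x)%E.
Proof.
have -> : gamma_integral x = (\int[mu]_(t in
    \bigcup_n (`[n.+1%:R^-1%R, n.+2%:R%R]%classic : set R)) (gamma_fun x t)%:E)%E.
  congr (integral mu _ _); apply/seteqP; split => t /=; last first.
    by case=> n _ /=; rewrite !in_itv/= andbT => /andP[+ _]; apply: lt_le_trans; rewrite invr_gt0.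
  rewrite in_itv/= andbT => t0.
  pose n := maxn (Num.truncn t) (Num.truncn t^-1).
  exists n => //=; rewrite in_itv/=; apply/andP; split.
    rewrite invf_ple ?posrE// (le_trans (ltW (truncnS_gt _)))// ler_nat.
    by rewrite ltnS leq_maxr.
  by rewrite (le_trans (ltW (truncnS_gt _)))// ler_nat ltnW// !ltnS leq_maxl.
apply: ge0_nondecreasing_set_cvg_integral => //.
- apply/nondecreasing_seqP => n; rewrite subsetEset => t /=; rewrite !in_itv/= => /andP[h1 h2].
  rewrite (le_trans _ h1) ?lef_pV2 ?posrE ?ler_nat//=.
  by rewrite (le_trans h2)// ler_nat.
- by move=> n; apply/measurable_EFinP; apply: measurable_funTS; exact: measurable_gamma_fun.
- by move=> n t _; rewrite lee_fin gamma_fun_ge0.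
Qed.

(** At 0 the power t^x vanishes because x > 0; at infinity the exponential majorant of
    [powR_expRN_le] wins. *)
Lemma cvg_gamma_boundary x : 0 < x ->
  (n.+1%:R^-1 `^ x * expR (- n.+1%:R^-1) - n.+2%:R `^ x * expR (- n.+2%:R) : R)
    @[n --> \oo] --> (0 : R).
Proof.
move=> x0; rewrite -[X in _ --> X](subr0 0); apply: cvgB.
  apply: (@squeeze_cvgr _ _ _ _ (fun=> 0) (fun n => n.+1%:R^-1 `^ x)).
  - near=> n; apply/andP; split; first by rewrite mulr_ge0 ?powR_ge0 ?expR_ge0.
    by rewrite ler_piMr ?powR_ge0// expR_le1 oppr_le0 invr_ge0.
  - exact: cvg_cst.
  - have /cvg_at_rightP := powR_cvg0 x0; apply; split; last exact: cvg_harmonic.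
    by move=> n; rewrite invr_gt0.
have [C C0 leC] := powR_expRN_le (ltW x0).
apply: (@squeeze_cvgr _ _ _ _ (fun=> 0) (fun n => C * expR (- (n.+2%:R / 2)))).
- near=> n; rewrite mulr_ge0 ?powR_ge0 ?expR_ge0//=.
  exact: leC.
- exact: cvg_cst.
- rewrite -[X in _ --> X](mulr0 C); apply: cvgM; first exact: cvg_cst.
  apply: (cvg_comp (fun n : nat => n.+2%:R / 2)%R (fun t => expR (- t))); last exact: cvgr_expR.
  apply/cvgryPge => A; near=> n; rewrite ler_pdivlMr//.
  rewrite (@le_trans _ _ n%:R) ?ler_nat ?leqW//; near: n; exact: nbhs_infty_ger.
Unshelve. all: end_near. Qed.

Lemma gamma_integralD1 x : 0 < x -> gamma_integral (x + 1) = (x%:E * gamma_integral x)%E.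
Proof.
move=> x0; rewrite -(cvg_lim (@ereal_hausdorff R) (@cvg_gamma_integral (x + 1))).
apply: cvg_lim => //.
rewrite -[X in _ --> X]add0e.
rewrite (_ : (fun _ => _) = (fun n : nat =>
  (n.+1%:R^-1 `^ x * expR (- n.+1%:R^-1) - n.+2%:R `^ x * expR (- n.+2%:R))%:E +
  x%:E * \int[mu]_(t in `[n.+1%:R^-1%R, n.+2%:R%R]) (gamma_fun x t)%:E)%E); last first.
  apply/funext => n; apply: gamma_integral_by_parts => //.
  by rewrite (@le_lt_trans _ _ 1)// ?invf_le1 ?ler1n ?ltr1n.
apply: cvgeD => //.
- by apply: cvg_EFin; [near=> n|exact: cvg_gamma_boundary].
- by apply: cvgeZl => //; exact: cvg_gamma_integral.
Unshelve. all: end_near. Qed.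

(** An infinite value at x would, by the functional equation, be infinite at x + 1 >= 1 as well. *)
Lemma gamma_integral_fin x : 0 < x -> gamma_integral x \is a fin_num.
Proof.
move=> x0; rewrite ge0_fin_numE ?gamma_integral_ge0//.
have : (gamma_integral (x + 1) < +oo)%E by apply: gamma_integral_fin1; lra.
rewrite gamma_integralD1//; have := gamma_integral_ge0 x.
by case: (gamma_integral x) => //= [r|]; rewrite ?ltry// gt0_muley ?lte_fin.
Qed.

Lemma euler_integralE x : euler_integral x = fine (gamma_integral x).
Proof. by []. Qed.

Lemma euler_integral_gt0 x : 0 < x -> 0 < euler_integral x.
Proof.
move=> x0; rewrite euler_integralE fine_gt0// gamma_integral_gt0/=.
by rewrite -ge0_fin_numE ?gamma_integral_ge0 ?gamma_integral_fin.
Qed.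

Lemma euler_integralD1 x : 0 < x -> euler_integral (x + 1) = x * euler_integral x.
Proof.
by move=> x0; rewrite !euler_integralE gamma_integralD1// fineM// gamma_integral_fin.
Qed.

Lemma Gamma_pos x : 0 < x -> Gamma x = euler_integral x.
Proof. by move=> x0; rewrite /Gamma x0 big_ord0 divr1 addr0. Qed.

Lemma Gamma_itvN10E x : -1 < x < 0 -> Gamma x = euler_integral (x + 1) / x.
Proof.
move=> x10; rewrite /Gamma ifF; last by apply/negbTE; rewrite -leNgt; lra.
rewrite (_ : Num.truncn (- x) = 0%N); last first.
  by apply: truncn_def; lra.
by rewrite big_ord_recl big_ord0 mulr1 addr0.
Qed.

(** On ]-1, 0[ this is one step of the continuation that defines [Gamma]; on the positive axis it is
    integration by parts. The range contains every H - 1/2 other than 0. *)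
Lemma GammaD1 x : -1 < x -> x != 0 -> Gamma (x + 1) = x * Gamma x.
Proof.
move=> xN1 x0; have [xlt0|xgt0|xE] := ltgtP x 0; last by rewrite xE eqxx in x0.
- rewrite (@Gamma_itvN10E x) ?xN1// Gamma_pos; last by lra.
  by field.
- by rewrite !Gamma_pos ?euler_integralD1//; lra.
Qed.

Lemma Gamma_neq0 x : -1 < x -> x != 0 -> Gamma x != 0.
Proof.
move=> xN1 x0; have [xlt0|xgt0|xE] := ltgtP x 0; last by rewrite xE eqxx in x0.
- rewrite Gamma_itvN10E ?xN1// mulf_neq0 ?invr_eq0// gt_eqF//.
  by apply: euler_integral_gt0; lra.
- by rewrite Gamma_pos// gt_eqF// euler_integral_gt0.
Qed.

Lemma Gamma1 : Gamma (1 : R) = 1.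
Proof. by rewrite Gamma_pos// euler_integralE gamma_integral1. Qed.

End gamma.

(** * Gaussian averages *)

Section density.
Context (d : measure_display) (T : measurableType d) (R : realType).
Variables (mu nu : {measure set T -> \bar R}) (p : T -> R).
Hypotheses (mp : measurable_fun setT p) (p0 : forall x, 0 <= p x).
Hypothesis nuE : forall A, measurable A -> nu A = (\int[mu]_(x in A) (p x)%:E)%E.
Local Open Scope ereal_scope.

Import HBNNSimple.

(** The usual ascent: indicators by hypothesis, simple functions by linearity, the general case by
    monotone convergence. *)
Lemma ge0_integral_density (f : T -> \bar R) : measurable_fun setT f ->
  (forall x, 0 <= f x) -> \int[nu]_x f x = \int[mu]_x (f x * (p x)%:E).
Proof.
have indicE A : measurable A ->
    \int[nu]_x (\1_A x)%:E = \int[mu]_x ((\1_A x)%:E * (p x)%:E).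
  move=> mA; rewrite integral_indic// setIT nuE// integral_mkcond.
  apply: eq_integral => x _; rewrite patchE indicE.
  by case: (x \in A); rewrite ?mul1e ?mul0e.
have sfunE (g : {nnsfun T >-> R}) :
    \int[nu]_x (g x)%:E = \int[mu]_x ((g x)%:E * (p x)%:E).
  under eq_integral do rewrite fimfunE -fsumEFin//.
  rewrite ge0_integral_fsum//; last 2 first.
  - by move=> r; exact/measurable_EFinP/measurableT_comp.
  - by move=> n x _; rewrite EFinM nnfun_muleindic_ge0.
  under [RHS]eq_integral.
    move=> x _; rewrite fimfunE -fsumEFin// ge0_mule_fsuml; last first.
      by move=> r; rewrite EFinM nnfun_muleindic_ge0.
    over.
  rewrite [RHS]ge0_integral_fsum//; last 2 first.
  - move=> r; apply: emeasurable_funM; last exact/measurable_EFinP.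
    by apply/measurable_EFinP; apply/measurableT_comp.
  - by move=> r x _; rewrite mule_ge0 ?lee_fin// -lee_fin EFinM nnfun_muleindic_ge0.
  apply: eq_fsbigr => r /[!inE] -[x _ <-].
  have gx0 : (0 <= g x)%R by [].
  under eq_integral do rewrite EFinM.
  rewrite ge0_integralZl//; last exact/measurable_EFinP.
  under [RHS]eq_integral do rewrite EFinM -muleA.
  rewrite [RHS]ge0_integralZl//.
  - by rewrite indicE.
  - by apply: emeasurable_funM => //; exact/measurable_EFinP.
  - by move=> y _; rewrite mule_ge0 ?lee_fin.
move=> mf f0; pose f_ := nnsfun_approx measurableT mf.
transitivity (lim (\int[nu]_x (f_ n x)%:E @[n --> \oo])).
  rewrite -monotone_convergence//=.
  - apply: eq_integral => ? /[!inE] xD; apply/esym/cvg_lim => //=.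
    exact: cvg_nnsfun_approx.
  - by move=> n; exact/measurable_EFinP/measurable_funTS.
  - by move=> n ? _; rewrite lee_fin.
  - by move=> ? _ ? ? mn; rewrite lee_fin; exact/lefP/nd_nnsfun_approx.
under eq_fun do rewrite sfunE.
rewrite -monotone_convergence//=.
- apply: eq_integral => x _; apply/cvg_lim => //.
  by apply: cvgeZr => //; exact: cvg_nnsfun_approx.
- move=> n; apply: emeasurable_funM; last exact/measurable_EFinP.
  exact/measurable_EFinP/measurable_funTS.
- by move=> n x _; rewrite mule_ge0 ?lee_fin.
- move=> x _ m n mn; rewrite lee_wpmul2r ?lee_fin//.
  exact/lefP/nd_nnsfun_approx.
Qed.

End density.

(** Lebesgue measure equals s times its image under x -> m + s x, because the two agree on half-open
    intervals. *)
Lemma ge0_integral_affine (R : realType) (m s : R) (f : R -> \bar R) :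
  0 < s -> measurable_fun setT f -> (forall x, (0 <= f x)%E) ->
  (\int[lebesgue_measure]_x f x =
   s%:E * \int[lebesgue_measure]_x f (m + s * x)%R)%E.
Proof.
move=> s0 mf f0.
pose phi (x : measurableTypeR R) : measurableTypeR R := m + s * x.
have mphi : measurable_fun setT phi.
  by apply: measurable_funD => //; exact: measurable_funM.
have snneg : (0 <= s) by exact: ltW.
pose nu' := mscale (NngNum snneg) (pushforward lebesgue_measure phi).
pose nu := nu' mphi.
have nuE X : ocitv X -> lebesgue_measure X = nu X.
  move=> [[a b] _ <-] /=; rewrite /nu /nu' /mscale/= /pushforward.
  have -> : phi @^-1` `]a, b] = `](a - m) / s, (b - m) / s]%classic.
    apply/seteqP; split => x /=; rewrite !in_itv/= /phi;
      by rewrite ltr_pdivrMr// ler_pdivlMr// ltrBlDl lerBrDl (mulrC x).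
  rewrite !lebesgue_measure_itv/= !lte_fin ltr_pM2r ?invr_gt0// ltrD2r.
  case: ifPn => ab; last by rewrite mule0.
  by rewrite -!EFinB -EFinM; congr EFin; field; rewrite gt_eqF.
rewrite (eq_measure_integral nu); last first.
  by move=> A mA _; exact: lebesgue_measure_unique.
rewrite ge0_integral_mscale//=; congr (_ * _)%E.
by rewrite (ge0_integral_pushforward mphi).
Qed.

(** * Convolution with Gaussian laws and their total variation under shifts *)

Section gauss_avg.
Context (R : realType).
Implicit Types (s a b y z : R) (f : R -> \bar R) (A : set R).
Local Notation mu := (@lebesgue_measure R).

(** As a function of [y], the convolution of f with the centred Gaussian of standard deviation [s]:
    the effect on f of adding an independent noise to [y]. *)
Definition gauss_avg s f y : \bar R :=
  (\int[mu]_z (f z * (normal_pdf y s z)%:E))%E.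

Lemma measurable_normal_pdf_pair s : s != 0 ->
  measurable_fun setT (fun yz : R * R => normal_pdf yz.1 s yz.2).
Proof.
move=> s0; rewrite (_ : (fun _ => _) =
    (fun x => normal_pdf 0 s x) \o (fun yz : R * R => yz.2 - yz.1)).
  by apply: measurableT_comp; [exact: measurable_normal_pdf|exact: measurable_funB].
by apply/funext => -[y z] /=; rewrite !normal_pdfE// /normal_fun subr0.
Qed.

Lemma gauss_avg_ge0 s f y : (forall x, 0 <= f x)%E -> (0 <= gauss_avg s f y)%E.
Proof.
by move=> f0; apply: integral_ge0 => z _; rewrite mule_ge0// lee_fin normal_pdf_ge0.
Qed.

Lemma measurable_gauss_avg s f : s != 0 -> measurable_fun setT f ->
  (forall x, 0 <= f x)%E -> measurable_fun setT (gauss_avg s f).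
Proof.
move=> s0 mf f0.
have := @measurable_fun_fubini_tonelli_F _ _ _ _ _ mu
  (fun yz => f yz.2 * (normal_pdf yz.1 s yz.2)%:E)%E.
apply.
- apply: emeasurable_funM; first exact: measurableT_comp.
  by apply/measurable_EFinP; exact: measurable_normal_pdf_pair.
- by move=> x; rewrite mule_ge0// lee_fin normal_pdf_ge0.
Qed.

Lemma gauss_avg_indic s A y : measurable A ->
  gauss_avg s (fun z => (\1_A z)%:E) y = normal_prob y s A.
Proof.
move=> mA; rewrite /gauss_avg /normal_prob [RHS]integral_mkcond.
apply: eq_integral => x _; rewrite patchE indicE.
by case: (x \in A); rewrite ?mul1e ?mul0e.
Qed.

Lemma normal_peakE s : 0 < s -> normal_peak s = (s * Num.sqrt (pi *+ 2))^-1.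
Proof.
move=> s0; rewrite /normal_peak -mulrnAr sqrtrM ?sqr_ge0// sqrtr_sqr.
by rewrite gtr0_norm.
Qed.

(** Substitution z = y + s w, which brings in the law of a single white noise variable. *)
Lemma gauss_avg_standard s f y : 0 < s -> measurable_fun setT f ->
  (forall x, 0 <= f x)%E ->
  gauss_avg s f y = (\int[normal_prob 0 1]_w f (y + s * w)%R)%E.
Proof.
move=> s0 mf f0.
have mp : measurable_fun setT (normal_pdf 0 1 : R -> R).
  exact: measurable_normal_pdf.
have maff : measurable_fun setT (fun w : R => y + s * w).
  by apply: measurable_funD => //; exact: measurable_funM.
have mg : measurable_fun setT (fun w : measurableTypeR R => f (y + s * w)).
  exact: measurableT_comp mf maff.
have g0 (w : measurableTypeR R) : (0 <= f (y + s * w)%R)%E by [].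
have := @ge0_integral_density _ (measurableTypeR R) R mu (normal_prob 0 1)
  (normal_pdf 0 1) mp (normal_pdf_ge0 0 1) (fun A _ => erefl) _ mg g0.
move=> /esym; apply: etrans.
rewrite /gauss_avg (@ge0_integral_affine R y s); last 2 first.
- apply: emeasurable_funM => //; apply/measurable_EFinP.
  exact: measurable_normal_pdf.
- by move=> x; rewrite mule_ge0// lee_fin normal_pdf_ge0.
rewrite -ge0_integralZl//; first last.
- by rewrite lee_fin ltW.
- by move=> x _; rewrite mule_ge0// lee_fin normal_pdf_ge0.
- apply: emeasurable_funM; first exact: measurableT_comp mf maff.
  apply/measurable_EFinP; apply: measurableT_comp maff.
  exact: measurable_normal_pdf.
apply: eq_integral => w _.
rewrite muleCA -EFinM; congr (_ * _%:E)%E.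
rewrite !normal_pdfE ?gt_eqF// !normal_peakE// /normal_fun subr0.
have pi0 : Num.sqrt (pi *+ 2) != 0 :> R.
  by rewrite gt_eqF// sqrtr_gt0 mulrn_wgt0// pi_gt0.
rewrite mulrA; congr (_ * expR _); field.
all: by rewrite ?pi0 ?gt_eqF.
Qed.

(** Completing the square: the joint density of two successive Gaussian steps y -> x -> z is the
    marginal density of z times the conditional density of x given z. *)
Lemma normal_pdfM a b x y z : 0 < a -> 0 < b ->
  let c := Num.sqrt (a ^+ 2 + b ^+ 2) in
  normal_pdf x b z * normal_pdf y a x =
  normal_pdf y c z *
    normal_pdf ((a ^+ 2 * z + b ^+ 2 * y) / c ^+ 2) (a * b / c) x.
Proof.
move=> a0 b0 c.
have ab0 : 0 < a ^+ 2 + b ^+ 2 by rewrite addr_gt0// exprn_gt0.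
have c0 : 0 < c by rewrite sqrtr_gt0.
have cE : c ^+ 2 = a ^+ 2 + b ^+ 2 by rewrite sqr_sqrtr// ltW.
have abc0 : 0 < a * b / c by rewrite divr_gt0// mulr_gt0.
rewrite !normal_pdfE ?gt_eqF// !normal_peakE// /normal_fun.
have pi0 : Num.sqrt (pi *+ 2) != 0 :> R.
  by rewrite gt_eqF// sqrtr_gt0 mulrn_wgt0// pi_gt0.
rewrite mulrACA -expRD [RHS]mulrACA -expRD; congr (_ * expR _).
  by field; rewrite pi0 !gt_eqF.
rewrite !exprMn !exprVn !cE.
by field; rewrite !gt_eqF//= exprn_gt0.
Qed.

(** Variances of independent Gaussians add: after Tonelli and the factorization of [normal_pdfM],
    the conditional density of the middle point integrates to 1. *)
Lemma gauss_avg_comp a b f y : 0 < a -> 0 < b -> measurable_fun setT f ->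
  (forall x, 0 <= f x)%E ->
  gauss_avg a (gauss_avg b f) y = gauss_avg (Num.sqrt (a ^+ 2 + b ^+ 2)) f y.
Proof.
move=> a0 b0 mf f0; rewrite /gauss_avg.
have a0' : a != 0 by rewrite gt_eqF.
have b0' : b != 0 by rewrite gt_eqF.
pose g (xz : R * R) := (f xz.2 * (normal_pdf xz.1 b xz.2)%:E *
                         (normal_pdf y a xz.1)%:E)%E.
transitivity (\int[mu]_x \int[mu]_z g (x, z))%E.
  apply: eq_integral => x _; rewrite -ge0_integralZr//=.
  - apply: emeasurable_funM => //; apply/measurable_EFinP.
    exact: measurable_normal_pdf.
  - by move=> z _; rewrite mule_ge0// lee_fin normal_pdf_ge0.
  - by rewrite lee_fin normal_pdf_ge0.
rewrite (@fubini_tonelli _ _ _ _ R mu mu); last 2 first.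
- apply: emeasurable_funM; first apply: emeasurable_funM.
  + exact: measurableT_comp.
  + by apply/measurable_EFinP; exact: measurable_normal_pdf_pair.
  + apply/measurable_EFinP; apply: measurableT_comp => //.
    exact: measurable_normal_pdf.
- by move=> xz; rewrite !mule_ge0// lee_fin normal_pdf_ge0.
apply: eq_integral => z _; rewrite /g /=.
under eq_integral do rewrite -muleA -EFinM normal_pdfM// EFinM muleA.
rewrite ge0_integralZl ?integral_normal_pdf ?mule1//.
- by apply/measurable_EFinP; exact: measurable_normal_pdf.
- by move=> x _; rewrite lee_fin normal_pdf_ge0.
- by rewrite mule_ge0// lee_fin normal_pdf_ge0.
Qed.

(** Integrates a pointwise inequality between densities. All coefficients are nonnegative, so
    negative terms must first be moved to the other side. *)
Lemma normal_prob_le s u v w A (al be ga : R) : measurable A ->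
  0 <= al -> 0 <= be -> 0 <= ga ->
  (forall x, al * normal_pdf u s x <=
             be * normal_pdf v s x + ga * normal_pdf w s x) ->
  al * fine (normal_prob u s A) <=
  be * fine (normal_prob v s A) + ga * fine (normal_prob w s A).
Proof.
move=> mA al0 be0 ga0 le_pdf.
have mpdf m : measurable_fun A (fun x => (normal_pdf m s x)%:E).
  by apply/measurable_EFinP; apply: measurable_funTS; exact: measurable_normal_pdf.
have pdf0 m x : (0 <= (normal_pdf m s x)%:E)%E.
  by rewrite lee_fin normal_pdf_ge0.
have probZ (m k : R) : 0 <= k -> (k * fine (normal_prob m s A))%:E =
    (\int[mu]_(x in A) (k%:E * (normal_pdf m s x)%:E))%E.
  move=> k0; rewrite EFinM fineK; last exact: fin_num_measure.
  by rewrite ge0_integralZl//; exact: mpdf.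
suff : ((al * fine (normal_prob u s A))%:E <=
    (be * fine (normal_prob v s A))%:E + (ga * fine (normal_prob w s A))%:E)%E.
  by rewrite -EFinD lee_fin.
rewrite (probZ u _ al0) (probZ v _ be0) (probZ w _ ga0).
rewrite -ge0_integralD//; last 4 first.
- by move=> x _; rewrite mule_ge0 ?lee_fin ?normal_pdf_ge0.
- by apply: measurable_funeM; exact: mpdf.
- by move=> x _; rewrite mule_ge0 ?lee_fin ?normal_pdf_ge0.
- by apply: measurable_funeM; exact: mpdf.
apply: ge0_le_integral => //.
- by move=> x _; rewrite mule_ge0 ?lee_fin ?normal_pdf_ge0.
- by apply: measurable_funeM; exact: mpdf.
- by apply: emeasurable_funD; apply: measurable_funeM; exact: mpdf.
- by move=> x _; rewrite -!EFinM -EFinD lee_fin.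
Qed.

(** From -2 (x - u)^2 + (x - v)^2 = -(x - (2 u - v))^2 + 2 (u - v)^2. Dividing by the density
    centred at v and integrating yields the chi-square divergence. *)
Lemma normal_pdf_chi2 s u v x : 0 < s ->
  normal_pdf u s x ^+ 2 =
  expR (((u - v) / s) ^+ 2) * normal_pdf (2 * u - v) s x * normal_pdf v s x.
Proof.
move=> s0; rewrite !normal_pdfE ?gt_eqF// /normal_fun.
set k := normal_peak s.
have kM (c e1 e2 : R) : c * (k * e1) * (k * e2) = k ^+ 2 * (c * e1 * e2) by ring.
rewrite exprMn kM -expRM_natl -!expRD; congr (_ * _); congr expR.
by field; rewrite gt_eqF.
Qed.

(* The total variation distance of two shifted normal laws is controlled by their
   chi-square divergence [k - 1], through [d <= e p / 2 + d^2 / (2 e p)] with [d] the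
   difference of the densities and [p] the reference density. *)
Lemma normal_prob_shift s u v A (e : R) : 0 < s -> 0 < e -> measurable A ->
  fine (normal_prob u s A) - fine (normal_prob v s A) <=
  e / 2 + (expR (((u - v) / s) ^+ 2) - 1) / (2 * e).
Proof.
move=> s0 e0 mA; set k := expR _; set w := 2 * u - v.
have k0 : 0 < k by exact: expR_gt0.
have pdf_gt0 m x : 0 < normal_pdf m s x.
  by rewrite normal_pdfE ?gt_eqF// mulr_gt0 ?expR_gt0// normal_peak_gt0 ?gt_eqF.
have kE x : k * normal_pdf w s x = normal_pdf u s x ^+ 2 / normal_pdf v s x.
  by rewrite (normal_pdf_chi2 u v x s0) mulfK// gt_eqF.
have ie0 : 0 < e^-1 by rewrite invr_gt0.
have [N NE] : exists N : R -> set R -> R,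
    forall m B, fine (normal_prob m s B) = N m B.
  by exists (fun m B => fine (normal_prob m s B)).
have NC m : N m (~` A) = 1 - N m A.
  by rewrite -!NE probability_setC// fineB ?fin_num_measure.
have N1 : N v A <= 1.
  by rewrite -NE -lee_fin fineK ?fin_num_measure ?probability_le1.
rewrite !NE.
(* The bound on d integrated over A, with d^2 / p expanded as q^2 / p - 2 q + p. *)
have h1 : (1 + e^-1) * N u A <=
    (1 + e / 2 + e^-1 / 2) * N v A +
    (k * e^-1 / 2) * N w A.
  rewrite -!NE; apply: normal_prob_le => //.
  - by rewrite addr_ge0// ltW.
  - by rewrite !addr_ge0// ltW// divr_gt0.
  - by rewrite ltW// divr_gt0// mulr_gt0.
  move=> x; rewrite -subr_ge0.
  rewrite (_ : k / e / 2 * _ = (k * normal_pdf w s x) / e / 2); last by lra.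
  rewrite kE; have := pdf_gt0 v x; set p := normal_pdf v s x.
  set q := normal_pdf u s x => p0.
  rewrite [leRHS](_ : _ = (e * p - (q - p)) ^+ 2 / (2 * e * p)).
    by rewrite divr_ge0 ?sqr_ge0// ltW// !mulr_gt0.
  by field; rewrite !gt_eqF.
(* Here d^2 / p >= 0 is integrated off A, so that its integral over A is at most its total k - 1. *)
have h2 : 2 * N u (~` A) <=
    1 * N v (~` A) + k * N w (~` A).
  rewrite -!NE; apply: normal_prob_le => //; first exact: measurableC.
  - exact: ltW.
  move=> x; rewrite -subr_ge0 kE.
  have := pdf_gt0 v x; set p := normal_pdf v s x.
  set q := normal_pdf u s x => p0.
  rewrite [leRHS](_ : _ = (q - p) ^+ 2 / p); last by field; rewrite gt_eqF.
  by rewrite divr_ge0 ?sqr_ge0// ltW.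
rewrite !NC in h2; move: h1 h2 N1.
move: (N u A) (N v A) (N w A) => qu qv qw h1 h2 qv1.
have h3 : (k * qw - 2 * qu + qv) / (2 * e) <= (k - 1) / (2 * e).
  by rewrite ler_pM2r ?invr_gt0 ?mulr_gt0//; lra.
have h4 : e / 2 * qv <= e / 2 by rewrite ler_piMr// ltW// divr_gt0.
have h5 : (k * qw - 2 * qu + qv) / (2 * e) =
  k * e^-1 / 2 * qw - e^-1 * qu + e^-1 / 2 * qv by field; rewrite gt_eqF.
lra.
Qed.

End gauss_avg.

(** * Equidistribution modulo 1 of wide Gaussians *)

Section equidistribution.
Context (R : realType).
Implicit Types (x u v s th ka : R).
Local Notation mu := (@lebesgue_measure R).

Lemma frac_itv x : 0 <= frac x < 1.
Proof. by rewrite subr_ge0 ge_floor/= ltrBlDr addrC -intrD1 floorD1_gt. Qed.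

Lemma fracD x v : 0 <= v < 1 ->
  frac (x + v) = if frac x + v < 1 then frac x + v else frac x + v - 1.
Proof.
move=> v01; have := frac_itv x; rewrite {2 3 4}/frac /frac => fx01.
case: ifPn => [lt1|]; last rewrite -leNgt => ge1.
  rewrite (_ : Num.floor (x + v) = Num.floor x); first by lra.
  by apply/Num.Theory.floor_def/andP; rewrite intrD; split; lra.
rewrite (_ : Num.floor (x + v) = (Num.floor x + 1)%R); first by rewrite intrD; lra.
by apply/Num.Theory.floor_def/andP; rewrite !intrD; split; lra.
Qed.

Definition frac_ge th ka : set R := [set z | th <= frac (z + ka)].

Lemma measurable_frac_ge th ka : measurable (frac_ge th ka).
Proof.
rewrite (_ : frac_ge th ka = (fun z => frac (z + ka)) @^-1` `[th, +oo[).
  rewrite -[X in measurable X]setTI; apply: (measurableT_comp (@measurable_frac R)) => //.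
  exact: measurable_funD.
by apply/seteqP; split => z /=; rewrite in_itv/= andbT.
Qed.

(** A rotation of the circle preserves length. Cut at 1 - r, with r the fractional part of [ka], the
    set is one interval when r <= th and two otherwise. *)
Lemma lebesgue_frac_ge th ka : 0 <= th <= 1 ->
  mu (`[0, 1[ `&` frac_ge th ka) = (1 - th)%:E.
Proof.
move=> th01; have := frac_itv ka; set r := frac ka => r01.
have frE v : 0 <= v < 1 ->
    frac_ge th ka v <-> th <= if r + v < 1 then r + v else r + v - 1.
  by move=> v01; rewrite /frac_ge/= addrC fracD.
have [rth|thr] := leP r th.
  rewrite (_ : _ `&` _ = `[th - r, 1 - r[%classic); last first.
    apply/seteqP; split => v /=; rewrite !in_itv/=.
      by case=> v01 /(frE _ v01); case: ifPn => ? ?; lra.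
    move=> vE; have v01 : 0 <= v < 1 by lra.
    by split => //; apply/frE => //; rewrite ifT; lra.
  rewrite lebesgue_measure_itv/= lte_fin; case: ifPn => ?.
    by rewrite -EFinB; congr EFin; lra.
  by congr EFin; lra.
rewrite (_ : _ `&` _ = `[0, 1 - r[%classic `|` `[1 - r + th, 1[%classic); last first.
  apply/seteqP; split => v /=; rewrite !in_itv/=.
    case=> v01 /(frE _ v01); case: ifPn => ? ?; first by left; lra.
    by right; lra.
  move=> vE; have v01 : 0 <= v < 1 by case: vE; lra.
  split => //; apply/frE => //.
  by case: vE => ?; [rewrite ifT; lra|rewrite ifF; [|apply/negbTE]; lra].
pose I : set R := `[0, 1 - r[%classic; pose J : set R := `[1 - r + th, 1[%classic.
transitivity (mu I + mu J)%E.
  apply: measureU => //.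
  by apply/seteqP; split => v //= [] /=; rewrite !in_itv/=; lra.
rewrite /I /J !lebesgue_measure_itv/= !lte_fin.
rewrite ifT; last by lra.
rewrite ifT; last by lra.
by rewrite -!EFinB -EFinD; congr EFin; lra.
Qed.

(** By Tonelli the shift v is integrated first, with the standard noise w fixed; each w then
    contributes exactly 1 - th, by [lebesgue_frac_ge] with offset u + s w + ka. *)
Lemma integral_normal_prob_frac_ge s u th ka : 0 < s -> 0 <= th <= 1 ->
  (\int[mu]_(v in `[0%R, 1%R[) normal_prob (u + v)%R s (frac_ge th ka) = (1 - th)%:E)%E.
Proof.
move=> s0 th01; set A := frac_ge th ka.
have mA : measurable A by exact: measurable_frac_ge.
have mI : measurable_fun setT (fun z => (\1_A z)%:E : \bar R).
  by apply/measurable_EFinP; exact: measurable_indic.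
pose g (vw : measurableTypeR R * measurableTypeR R) : \bar R :=
  ((\1_(`[0%R, 1%R[%classic) vw.1)%:E * (\1_A (u + vw.1 + s * vw.2)%R)%:E)%E.
have m01 : measurable_fun setT (\1_(`[0, 1[%classic : set R) : R -> R).
  exact: measurable_indic.
have mg : measurable_fun setT g.
  apply: emeasurable_funM.
    apply/measurable_EFinP; exact: (measurableT_comp m01).
  apply/measurable_EFinP; apply: (measurableT_comp (measurable_indic mA)).
  apply: measurable_funD; first exact: measurable_funD.
  exact: measurable_funM.
rewrite integral_mkcond.
transitivity (\int[mu]_v \int[normal_prob 0 1]_w g (v, w))%E.
  apply: eq_integral => v _; rewrite patchE /g/= indicE.
  case: ifPn => v01; last by rewrite integral0_eq// => x _; rewrite mul0e.
  rewrite -gauss_avg_indic// gauss_avg_standard//.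
  by apply: eq_integral => w _; rewrite mul1e.
have g0 vw : (0 <= g vw)%E by rewrite mule_ge0 ?lee_fin.
rewrite fubini_tonelli//=.
transitivity (\int[normal_prob 0 1]_w cst (1 - th)%:E w)%E; last first.
  rewrite integral_cst// [X in (_ * X)%E](_ : _ = 1%E) ?mule1//.
  exact: probability_setT.
apply: eq_integral => w _; rewrite /g/= -(lebesgue_frac_ge (u + s * w + ka) th01).
rewrite -[X in mu X]setIT -integral_indic//=; last first.
  by apply: measurableI => //; exact: measurable_frac_ge.
apply: eq_integral => v _; rewrite indicI/= EFinM; congr (_ * _%:E)%E.
rewrite !indicE; congr (nat_of_bool _)%:R.
by apply/idP/idP; rewrite !inE /A /frac_ge/=;
  rewrite (_ : u + v + s * w + ka = v + (u + s * w + ka))//; ring.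
Qed.

(** The probabilities for shifts in [0, 1[ differ pairwise by at most the shift bound and average to
    1 - th, so the unshifted one is that close to 1 - th. *)
Lemma normal_prob_frac_ge s u th ka (e : R) : 0 < s -> 0 <= th <= 1 -> 0 < e ->
  `|fine (normal_prob u s (frac_ge th ka)) - (1 - th)| <=
  e / 2 + (expR (s ^- 2) - 1) / (2 * e).
Proof.
move=> s0 th01 e0; set A := frac_ge th ka; set K := e / 2 + _.
have mA : measurable A by exact: measurable_frac_ge.
pose q v := fine (normal_prob (u + v) s A).
have qE v : normal_prob (u + v) s A = (q v)%:E by rewrite fineK ?fin_num_measure.
have mq : measurable_fun setT q.
  rewrite (_ : q = fine \o gauss_avg s (fun z => (\1_A z)%:E) \o (fun v => u + v)).
    apply: measurableT_comp; last exact: measurable_funD.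
    apply: measurableT_comp; first exact: fine_measurable.
    apply: measurable_gauss_avg; first by rewrite gt_eqF.
      by apply/measurable_EFinP; exact: measurable_indic.
    by move=> x; rewrite lee_fin.
  by apply/funext => v; rewrite /= gauss_avg_indic.
have q0 v : 0 <= q v by rewrite fine_ge0.
have qle v w : 0 <= v < 1 -> 0 <= w < 1 -> q v <= q w + K.
  move=> v01 w01; rewrite -lerBlDl (le_trans (normal_prob_shift _ _ s0 e0 mA))//.
  rewrite /K lerD2l ler_pM2r ?invr_gt0 ?mulr_gt0// lerD2r ler_expR.
  rewrite expr_div_n ler_piMl ?invr_ge0 ?sqr_ge0//.
  by rewrite -real_normK ?num_real// expr_le1// ler_norml; lra.
have intq : (\int[mu]_(v in `[0%R, 1%R[) (q v)%:E = (1 - th)%:E)%E.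
  rewrite -(integral_normal_prob_frac_ge u ka s0 th01).
  by apply: eq_integral => v _; rewrite qE.
have mu01 : mu `[0, 1[%classic = 1%E.
  by rewrite lebesgue_measure_itv/= lte_fin ltr01 oppr0 adde0.
have K0 : 0 <= K.
  by have := qle 0 0; lra.
have mD (f : R -> R) : measurable_fun setT f ->
    measurable_fun (`[0, 1[%classic : set (measurableTypeR R)) (EFin \o f).
  by move=> mf; apply/measurable_EFinP; exact: measurable_funTS.
have intc c : (\int[mu]_(v in `[0%R, 1%R[) c%:E = c%:E)%E.
  by rewrite integral_cst//= mu01 mule1.
have -> : fine (normal_prob u s A) = q 0 by rewrite /q addr0.
rewrite ler_distl; apply/andP; split.
  rewrite lerBlDr -lee_fin -intq EFinD -[X in (_ <= _ + X)%E]intc.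
  rewrite -[X in (_ <= X + _)%E]intc -ge0_integralD//; last first.
    by move=> x _; rewrite lee_fin.
  apply: ge0_le_integral => //.
  - by move=> x _; rewrite lee_fin.
  - exact: mD.
  - by move=> x /=; rewrite in_itv/= -EFinD lee_fin => x01; apply: qle => //; lra.
rewrite -lee_fin EFinD -intq -[X in (X <= _)%E]intc -[X in (_ <= _ + X)%E]intc.
rewrite -ge0_integralD//; last 2 first.
- by move=> x _; rewrite lee_fin.
- exact: mD.
apply: ge0_le_integral => //.
- by move=> x _; rewrite lee_fin.
- by apply: emeasurable_funD => //; exact: mD.
- by move=> x /=; rewrite in_itv/= -EFinD lee_fin => x01; apply: qle => //; lra.
Qed.

End equidistribution.

(** * Gaussian noise given its past *)

Section independence.
Local Open Scope ereal_scope.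
Context (d d1 d2 : measure_display) (T : measurableType d)
  (T1 : measurableType d1) (T2 : measurableType d2) (R : realType)
  (P : probability T R).

(** Independence identifies the joint law with the product of the laws on rectangles, hence
    everywhere; Tonelli then integrates [Y] out. *)
Lemma ge0_integral_independent (X : {RV P >-> T1}) (Y : {RV P >-> T2})
    (F : T1 * T2 -> \bar R) :
  (forall A B, measurable A -> measurable B ->
    P (X @^-1` A `&` Y @^-1` B) = P (X @^-1` A) * P (Y @^-1` B)) ->
  measurable_fun setT F -> (forall z, 0 <= F z) ->
  \int[P]_w F (X w, Y w) = \int[P]_w \int[distribution P Y]_y F (X w, y).
Proof.
move=> indep mF F0.
pose Z w := (X w, Y w).
have mZ : measurable_fun setT Z by exact: measurable_fun_pair.
pose Z' : {RV P >-> (T1 * T2)%type} :=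
  HB.pack Z (isMeasurableFun.Build _ _ _ _ _ mZ).
transitivity (\int[distribution P Z']_z F z).
  by rewrite ge0_integral_distribution.
rewrite (@eq_measure_integral _ _ _ _ (distribution P X \x distribution P Y)).
  rewrite fubini_tonelli1// ge0_integral_distribution//.
    exact: measurable_fun_fubini_tonelli_F.
  by move=> x; exact: integral_ge0.
move=> A mA _; rewrite -(@product_measure_unique _ _ _ _ _
  (distribution P X) (distribution P Y) (distribution P Z'))// => B C mB mC.
Qed.

End independence.

(** * The sigma-algebras generated by the past of the noise *)

Section past.
Context (d : measure_display) (T : measurableType d) (R : realType)
  (P : probability T R) (W : nat -> {RV P >-> R}).
Implicit Types (m n i : nat) (A : set R) (E B : set T).

(** A generating family stable under intersection, as the uniqueness theorem for measures requires.
    The past at time [m] consists of W_0, ..., W_(m-1). *)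
Definition past_rect m : set (set T) :=
  [set E | exists2 A : nat -> set R, (forall i, measurable (A i)) &
    E = \bigcap_(i in [set i | (i < m)%N]) (W i @^-1` A i)].

Definition past m : set (set T) := <<s past_rect m >>.

Local Notation pastType m := (g_sigma_algebraType (past_rect m)).

Lemma past_rectI m : setI_closed (past_rect m).
Proof.
move=> _ _ [A mA ->] [B mB ->]; exists (fun i => A i `&` B i).
  by move=> i; exact: measurableI.
by rewrite -bigcapI.
Qed.

Lemma past_rectT m : past_rect m setT.
Proof.
by exists (fun=> setT) => //; apply/esym; rewrite -subTset => w _ i _.
Qed.

Lemma past_rect_measurable m : past_rect m `<=` measurable.
Proof.
move=> _ [A mA ->]; case: m => [|m].
  by rewrite (_ : [set i | _] = set0) ?bigcap_set0//; apply/seteqP; split.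
apply: bigcap_measurable; first by exists 0%N.
by move=> i _; rewrite -[X in measurable X]setTI; exact: measurable_funP.
Qed.

Lemma past_measurable m : past m `<=` measurable.
Proof.
by apply: smallest_sub;
  [exact: sigma_algebra_measurable|exact: past_rect_measurable].
Qed.

Lemma le_past m n : (m <= n)%N -> past m `<=` past n.
Proof.
move=> mn; apply: smallest_sub; first exact: smallest_sigma_algebra.
move=> _ [A mA ->]; apply: sub_gen_smallest.
exists (fun i => if (i < m)%N then A i else setT); first by move=> i; case: ifP.
apply/seteqP; split => w /= Aw i /= im.
  by case: ifPn => // im'; exact: Aw.
by have := Aw i (leq_trans im mn); rewrite im.
Qed.

Lemma past_measurable_fun m (Y : T -> R) :
  measurable_fun setT (Y : pastType m -> R) -> measurable_fun setT Y.
Proof.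
by move=> mY _ A mA; apply: (@past_measurable m); exact: mY.
Qed.

Lemma le_past_measurable_fun m n (Y : T -> R) : (m <= n)%N ->
  measurable_fun setT (Y : pastType m -> R) ->
  measurable_fun setT (Y : pastType n -> R).
Proof.
by move=> mn mY mT A mA; apply: (le_past mn); exact: mY.
Qed.

Lemma past_measurable_noise m i : (i < m)%N ->
  measurable_fun setT (W i : pastType m -> R).
Proof.
move=> im _ A mA; rewrite setTI; apply: sub_gen_smallest.
exists (fun j => if j == i then A else setT); first by move=> j; case: ifP.
apply/seteqP; split => w /=.
  by move=> Aw j _ /=; case: eqP => // ->.
by move=> /(_ i im); rewrite /= eqxx.
Qed.

(** Both sides are finite measures in [E], and mutual independence makes them agree on the
    rectangles that generate the past. *)
Lemma past_independent m E A : mutually_independent P W ->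
  past m E -> measurable A ->
  P (E `&` W m @^-1` A) = (P E * P (W m @^-1` A))%E.
Proof.
move=> indW pE mA.
have mWA : measurable (W m @^-1` A).
  by rewrite -[X in measurable X]setTI; exact: measurable_funP.
have k0 : 0 <= fine (P (W m @^-1` A)) by rewrite fine_ge0.
pose nu := mscale (NngNum k0) P.
have nuE B : nu B = (P B * P (W m @^-1` A))%E.
  by rewrite /nu /mscale/= fineK ?fin_num_measure// muleC.
rewrite -nuE -[LHS]/(mrestr P mWA E).
apply: (g_sigma_algebra_measure_unique (past_rect m) _ (fun=> setT)) pE => //.
- exact: past_rect_measurable.
- by move=> _; exact: past_rectT.
- by rewrite bigcup_const//; exists 0%N.
- exact: past_rectI.
- move=> _ [C mC ->]; rewrite [RHS](nuE _) /= /mrestr.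
  (* Putting [A] at index m turns the event into one intersection over J and m, to which mutual
     independence applies. *)
  pose C' j := if j == m then A else C j.
  have mC' j : measurable (C' j) by rewrite /C'; case: ifP.
  pose J := [fset i in iota 0 m]%fset.
  have JE i : (i \in J) = (i < m)%N by rewrite !inE mem_iota.
  have mJ : m \notin J by rewrite JE ltnn.
  have C'E i : i \in J -> C' i = C i.
    by rewrite JE /C' => im; rewrite ltn_eqF.
  have C'm : C' m = A by rewrite /C' eqxx.
  have := indW (m |` J)%fset C' mC'; rewrite big_fsetU1//= -(indW J C' mC') C'm.
  rewrite [RHS]muleC (_ : \bigcap_(i in [set` (m |` J)%fset]) _ =
    \bigcap_(i in [set i | (i < m)%N]) W i @^-1` C i `&` W m @^-1` A).
    move=> ->; congr (P _ * _)%E; apply/seteqP; split => w Cw i /=.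
      by rewrite -JE => iJ; rewrite -C'E//; exact: Cw.
    by move=> iJ; rewrite C'E//; apply: Cw; rewrite /= -JE.
  apply/seteqP; split => w /=.
    move=> Cw; split; last by have := Cw m; rewrite /= C'm; apply; rewrite !inE eqxx.
    move=> i /= im; have iJ : i \in J by rewrite JE.
    by rewrite -C'E//; apply: Cw; rewrite /= !inE mem_iota im orbT.
  move=> [Cw Aw] i /=; rewrite in_fset1U => /orP[/eqP ->|iJ]; first by rewrite C'm.
  by rewrite C'E//; apply: Cw; rewrite /= -JE.
- move=> n; rewrite /= /mrestr (le_lt_trans (probability_le1 _ _)) ?ltry//.
  exact: measurableI.
Qed.

(** The pair of [Y] and the indicator of [B] belongs to the past, hence is independent of W_m, which
    can be averaged out with the past frozen. *)
Lemma ge0_integral_past m B (Y : T -> R) (a : R) (f : R -> \bar R) :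
  gaussian_white_noise P W -> past m B ->
  measurable_fun setT (Y : pastType m -> R) -> 0 < a ->
  measurable_fun setT f -> (forall x, 0 <= f x)%E ->
  (\int[P]_(w in B) f (Y w + a * W m w)%R = \int[P]_(w in B) gauss_avg a f (Y w))%E.
Proof.
move=> [indW lawW] pB mY a0 mf f0.
pose Z w : R * R := (Y w, \1_B w).
have mZp : measurable_fun setT (Z : pastType m -> (R * R)%type).
  exact: measurable_fun_pair.
have mZ : measurable_fun setT Z.
  by move=> _ A mA; apply: (@past_measurable m); exact: mZp.
pose Z' : {RV P >-> (R * R)%type} :=
  HB.pack Z (isMeasurableFun.Build _ _ _ _ _ mZ).
pose Wm : T -> measurableTypeR R := W m.
have mWm : measurable_fun setT Wm by exact: (measurable_funP (W m)).
pose W' : {RV P >-> measurableTypeR R} :=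
  HB.pack Wm (isMeasurableFun.Build _ _ _ _ _ mWm).
(* The absolute value makes [F] nonnegative on the whole space; on the values 0 and 1 of the
   indicator it changes nothing. *)
pose F (zw : (R * R) * measurableTypeR R) : \bar R :=
  (f (zw.1.1 + a * zw.2)%R * `|zw.1.2|%:E)%E.
have mF : measurable_fun setT F.
  apply: emeasurable_funM.
    apply: measurableT_comp => //; apply: measurable_funD.
      by apply: measurableT_comp => //.
    exact: measurable_funM.
  apply/measurable_EFinP; apply: measurableT_comp => //.
  exact: measurableT_comp.
have F0 zw : (0 <= F zw)%E by rewrite mule_ge0 ?lee_fin.
have mB : measurable B by exact: past_measurable pB.
transitivity (\int[P]_w F (Z' w, W' w))%E.
  rewrite integral_mkcond; apply: eq_integral => w _.
  by rewrite patchE /F/= indicE; case: (w \in B); rewrite ?normr1 ?mule1 ?normr0 ?mule0.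
rewrite ge0_integral_independent//; last first.
  move=> A C mA mC; apply: past_independent => //.
  by rewrite -[X in past m X]setTI; exact: mZp.
rewrite [RHS]integral_mkcond; apply: eq_integral => w _.
transitivity (\int[normal_prob 0 1]_y F (Z w, y))%E.
  by apply: eq_measure_integral => A mA _; exact: lawW.
rewrite patchE gauss_avg_standard// /F/= indicE.
case: (w \in B).
  by apply: eq_integral => y _; rewrite normr1 mule1.
by rewrite integral0_eq// => y _; rewrite normr0 mule0.
Qed.

End past.

(** * Averaging out all the noise after a given time *)

Section asymptotics.
Context (d : measure_display) (T : measurableType d) (R : realType)
  (P : probability T R) (W : nat -> {RV P >-> R}).
Hypothesis gW : gaussian_white_noise P W.
Local Notation pastType m := (g_sigma_algebraType (past_rect W m)).

Lemma past_measurable_sum (a : nat -> R) m n : (m <= n)%N ->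
  measurable_fun setT ((fun w => \sum_(i < m) a i * W i w) : pastType n -> R).
Proof.
move=> mn; apply: measurable_sum => i; apply: measurable_funM => //.
by apply: past_measurable_noise; exact: leq_trans mn.
Qed.

(** Induction on [k]: the latest noise is averaged out first, which replaces f by its Gaussian
    average, and [gauss_avg_comp] merges the variances. The sum has k + 1 terms, so its variance is
    positive. *)
Lemma ge0_integral_past_sum (a : nat -> R) m k B (Y : T -> R) (f : R -> \bar R) :
  (forall j, 0 < a j) -> past W m B -> measurable_fun setT (Y : pastType m -> R) ->
  measurable_fun setT f -> (forall x, 0 <= f x)%E ->
  (\int[P]_(w in B) f (Y w + \sum_(m <= j < (m + k).+1) a j * W j w)%R =
   \int[P]_(w in B)
     gauss_avg (Num.sqrt (\sum_(m <= j < (m + k).+1) a j ^+ 2)) f (Y w))%E.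
Proof.
move=> a0 pB mY.
elim: k f => [|k IHk] f mf f0.
  under eq_integral do rewrite addn0 big_nat1.
  by rewrite (ge0_integral_past gW pB mY (a0 m) mf f0) addn0 big_nat1 sqrtr_sqr gtr0_norm.
pose S w := \sum_(m <= j < (m + k).+1) a j * W j w.
have mS : measurable_fun setT
    ((fun w => Y w + S w) : pastType (m + k).+1 -> R).
  apply: measurable_funD.
    by apply: le_past_measurable_fun mY; rewrite leqW// leq_addr.
  rewrite (_ : S = fun w => \sum_(i < (m + k).+1)
      (if (m <= i)%N then a i else 0) * W i w).
    exact: (@past_measurable_sum (fun i => if (m <= i)%N then a i else 0)).
  apply/funext => w; rewrite /S (big_nat_widenl _ 0%N)//= big_mkord big_mkcond.
  by apply: eq_bigr => i _; case: ifP => //; rewrite mul0r.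
have leB : past W (m + k).+1 B by apply: le_past pB; rewrite leqW// leq_addr.
have var0 : 0 < \sum_(m <= j < (m + k).+1) a j ^+ 2.
  rewrite big_nat_recr ?leq_addr//= ltr_wpDl ?exprn_gt0//.
  by apply: sumr_ge0 => j _; rewrite sqr_ge0.
have a0' := a0 (m + k).+1; have sv0 : 0 < Num.sqrt (\sum_(m <= j < (m + k).+1) a j ^+ 2).
  by rewrite sqrtr_gt0.
transitivity (\int[P]_(w in B) gauss_avg (a (m + k).+1) f (Y w + S w)%R)%E.
  rewrite -(ge0_integral_past gW leB mS a0' mf f0); apply: eq_integral => w _.
  by rewrite addnS big_nat_recr ?leqW ?leq_addr//= addrA.
have mavg : measurable_fun setT (gauss_avg (a (m + k).+1) f).
  by apply: measurable_gauss_avg => //; rewrite gt_eqF.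
have avg0 x : (0 <= gauss_avg (a (m + k).+1) f x)%E by exact: gauss_avg_ge0.
apply: (etrans (IHk _ mavg avg0)); apply: eq_integral => w _; rewrite (gauss_avg_comp _ sv0 a0' mf f0).
rewrite (sqr_sqrtr (ltW var0)) addnS; congr (gauss_avg (Num.sqrt _) _ _).
by rewrite [RHS]big_nat_recr//= leqW// leq_addr.
Qed.

(** With the later noise averaged out, the integrand on [B] is a Gaussian probability centred at
    [Y]; its distance to 1 - th is bounded independently of the centre, so the bound survives
    integration over [B]. *)
Lemma prob_frac_ge_past (a : nat -> R) m k B (Y : T -> R) (th ka e : R) :
  (forall j, 0 < a j) -> past W m B -> measurable_fun setT (Y : pastType m -> R) ->
  0 <= th <= 1 -> 0 < e ->
  `|fine (P (B `&` [set w |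
      th <= frac (Y w + \sum_(m <= j < (m + k).+1) a j * W j w + ka)])) -
    (1 - th) * fine (P B)| <=
  e / 2 + (expR (\sum_(m <= j < (m + k).+1) a j ^+ 2)^-1 - 1) / (2 * e).
Proof.
move=> a0 pB mY th01 e0; set v := (\sum_(m <= j < (m + k).+1) a j ^+ 2).
have v0 : 0 < v.
  rewrite /v big_nat_recr ?leq_addr//= ltr_wpDl ?exprn_gt0//.
  by apply: sumr_ge0 => j _; rewrite sqr_ge0.
pose A := frac_ge th ka; have mA : measurable A by exact: measurable_frac_ge.
have mB : measurable B by exact: past_measurable pB.
have mYT : measurable_fun setT Y by exact: past_measurable_fun mY.
pose X w := Y w + \sum_(m <= j < (m + k).+1) a j * W j w.
have mX : measurable_fun setT X.
  apply: measurable_funD => //; apply: measurable_sum => j.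
  exact: measurable_funM.
have mXA : measurable (X @^-1` A) by rewrite -[X in measurable X]setTI; exact: mX.
pose q y := fine (normal_prob y (Num.sqrt v) A).
set K := e / 2 + _.
have qK y : `|q y - (1 - th)| <= K.
  rewrite (_ : K = e / 2 + (expR (Num.sqrt v ^- 2) - 1) / (2 * e)); last first.
    by rewrite /K sqr_sqrtr// ltW.
  by apply: normal_prob_frac_ge => //; rewrite sqrtr_gt0.
have q0 y : 0 <= q y by rewrite fine_ge0.
have PE : P (B `&` X @^-1` A) = (\int[P]_(w in B) (q (Y w))%:E)%E.
  rewrite setIC -integral_indic//.
  transitivity (\int[P]_(w in B) (\1_A (X w))%:E)%E; first by [].
  rewrite (@ge0_integral_past_sum a m k B Y (fun x => (\1_A x)%:E))//.
  - apply: eq_integral => w _; rewrite gauss_avg_indic//.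
    by rewrite fineK ?fin_num_measure.
  - by apply/measurable_EFinP; exact: measurable_indic.
have mq : measurable_fun B (fun w => (q (Y w))%:E).
  apply: measurable_funTS; apply/measurable_EFinP; apply: measurableT_comp => //.
  rewrite (_ : q = fine \o gauss_avg (Num.sqrt v) (fun z => (\1_A z)%:E)).
    apply: measurableT_comp; first exact: fine_measurable.
    apply: measurable_gauss_avg; first by rewrite gt_eqF ?sqrtr_gt0.
      by apply/measurable_EFinP; exact: measurable_indic.
    by move=> x; rewrite lee_fin.
  by apply/funext => y; rewrite /= gauss_avg_indic.
have K0 : 0 <= K by exact: le_trans (qK 0).
have intc c : (\int[P]_(w in B) c%:E = (c * fine (P B))%:E)%E.
  by rewrite integral_cst// EFinM fineK ?fin_num_measure.
have PB1 : fine (P B) <= 1.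
  by rewrite -lee_fin fineK ?fin_num_measure ?probability_le1.
have PB0 : 0 <= fine (P B) by rewrite fine_ge0.
have KPB : K * fine (P B) <= K by rewrite ler_piMr.
rewrite -[[set w | _]]/(X @^-1` A) ler_distl.
have PXE : (fine (P (B `&` X @^-1` A)))%:E = (\int[P]_(w in B) (q (Y w))%:E)%E.
  by rewrite fineK ?fin_num_measure//; exact: measurableI.
have up : fine (P (B `&` X @^-1` A)) <= (1 - th + K) * fine (P B).
  rewrite -lee_fin PXE -intc; apply: ge0_le_integral => //.
  - by move=> w _; rewrite lee_fin.
  - by move=> w _; rewrite lee_fin; have := qK (Y w); rewrite ler_distl => /andP[].
have lo : (1 - th) * fine (P B) <= fine (P (B `&` X @^-1` A)) + K * fine (P B).
  rewrite -lee_fin EFinD PXE -!intc -ge0_integralD//; last first.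
    by move=> w _; rewrite lee_fin.
  apply: ge0_le_integral => //.
  - by move=> w _; rewrite lee_fin; lra.
  - exact: emeasurable_funD.
  - move=> w _; rewrite -EFinD lee_fin; have := qK (Y w).
    by rewrite ler_distl lerBlDr => /andP[].
by apply/andP; split; lra.
Qed.

End asymptotics.

(** * Fractional Gaussian noise *)

Section coefficients.
Context (R : realType).
Implicit Types (a : R) (n : nat).

Lemma fgn_coef0 a : -1 < a -> a != 0 -> fgn_coef a 0 = 1.
Proof.
by move=> a1 a0; rewrite /fgn_coef !add0r Gamma1 mulr1 divff// Gamma_neq0.
Qed.

(** The functional equation applied at n + a and at n + 1, both above -1 and nonzero. *)
Lemma fgn_coefS a n : -1 < a -> a != 0 ->
  fgn_coef a n.+1 = fgn_coef a n * ((n%:R + a) / n.+1%:R).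
Proof.
move=> a1 a0; rewrite /fgn_coef -!natr1.
have na1 : -1 < n%:R + a by rewrite ltr_wpDl.
have na0 : n%:R + a != 0.
  case: n {na1} => [|n]; first by rewrite add0r.
  by rewrite gt_eqF// -natr1 -addrA ltr_wpDl//; lra.
have n1 : n%:R + 1 != 0 :> R by rewrite natr1.
have n1' : -1 < n%:R + 1 :> R by rewrite (lt_trans (ltrN10 _))// ltr_wpDl.
rewrite (addrAC _ 1 a) (GammaD1 na1 na0) (GammaD1 n1' n1).
by field; rewrite !Gamma_neq0// n1.
Qed.

(** The coefficient of z^n in (1 - z)^(-a-1), the noise coefficients being those of (1 - z)^(-a). At
    a = 0 it is constantly 1, which covers H = 1/2. *)
Definition fgn_sum_coef a n : R := \prod_(k < n) (1 + a / k.+1%:R).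

Lemma fgn_sum_coefE a n : -1 < a -> a != 0 ->
  \sum_(k < n.+1) fgn_coef a k = fgn_sum_coef a n.
Proof.
move=> a1 a0.
have coefS m : fgn_coef a m.+1 = fgn_sum_coef a m * (a / m.+1%:R).
  elim: m => [|m IHm].
    by rewrite fgn_coefS// fgn_coef0// /fgn_sum_coef big_ord0 add0r.
  rewrite fgn_coefS// IHm /fgn_sum_coef big_ord_recr/=.
  by field; rewrite ?nat1r -?natrD !pnatr_eq0.
elim: n => [|n IHn].
  by rewrite big_ord_recr !big_ord0/= /fgn_sum_coef big_ord0 add0r fgn_coef0.
rewrite big_ord_recr/= IHn coefS /fgn_sum_coef [in RHS]big_ord_recr/=.
by rewrite mulrDr mulr1.
Qed.

Lemma fgn_sum_coef_gt0 a n : -1 < a -> 0 < fgn_sum_coef a n.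
Proof.
move=> a1; apply: prodr_gt0 => k _.
have k0 : 0 < k.+1%:R :> R by [].
rewrite -ltrBlDl sub0r ltr_pdivlMr// mulN1r.
by rewrite (le_lt_trans _ a1)// lerN2 ler1n.
Qed.

(* [(1 + a / k)^2 >= 1 + 2 a / k >= (k - 1) / k] telescopes from [k = 2] on. *)
Lemma fgn_sum_coef_sqr_ge a n : - 2^-1 < a ->
  (4 * n.+1%:R)^-1 <= fgn_sum_coef a n ^+ 2.
Proof.
move=> a2.
(* The index is shifted by one so that the induction starts from (1 + a)^2 >= 1/4. *)
have ge m : (4 * m.+1%:R)^-1 <= fgn_sum_coef a m.+1 ^+ 2.
  elim: m => [|m IHm].
    rewrite /fgn_sum_coef big_ord_recr big_ord0/= mul1r divr1 mulr1.
    by rewrite -[leLHS](_ : (2^-1) ^+ 2 = _) ?ler_pXn2r ?nnegrE//; [lra|lra|field].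
  rewrite /fgn_sum_coef big_ord_recr/= -/(fgn_sum_coef a m.+1) exprMn.
  have m1 : 0 < m.+1%:R :> R by [].
  have m2 : 0 < m.+2%:R :> R by [].
  have -> : (4 * m.+2%:R)^-1 = (4 * m.+1%:R)^-1 * (m.+1%:R / m.+2%:R) :> R.
    by field; rewrite ?nat1r -?natrD !pnatr_eq0.
  apply: ler_pM; [by rewrite invr_ge0 mulr_ge0|by rewrite divr_ge0|exact: IHm|].
  rewrite ler_pdivrMr//.
  have -> : (1 + a / m.+2%:R) ^+ 2 * m.+2%:R = m.+2%:R + 2 * a + a ^+ 2 / m.+2%:R.
    by field; rewrite ?nat1r -?natrD pnatr_eq0.
  have : 0 <= a ^+ 2 / m.+2%:R by rewrite divr_ge0 ?sqr_ge0.
  move: (a ^+ 2 / m.+2%:R) => q q0.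
  have : m.+2%:R = m.+1%:R + 1 :> R by rewrite natr1.
  by lra.
case: n => [|n].
  by rewrite /fgn_sum_coef big_ord0 expr1n mulr1 invf_le1//; lra.
apply: le_trans (ge n); rewrite lef_pV2 ?posrE ?mulr_gt0// ler_pM2l// ler_nat.
exact: leqnSn.
Qed.

(** In the double sum W_j is weighted by the coefficients of index 0 to n - j, whose sum is the
    product above. *)
Lemma sum_fgn d (T : measurableType d) (H : R) (W : nat -> {mfun T >-> R}) n w :
  0 < H < 1 ->
  \sum_(i < n.+1) fgn H W i w =
  \sum_(j < n.+1) fgn_sum_coef (H - 2^-1) (n - j) * W j w.
Proof.
move=> H01; rewrite /fgn; case: eqP => [->|/eqP H12].
  apply: eq_bigr => j _; rewrite subrr /fgn_sum_coef big1 ?mul1r// => k _.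
  by rewrite mul0r addr0.
set a := H - 2^-1; have a1 : -1 < a by rewrite /a; lra.
have a0 : a != 0 by rewrite subr_eq0.
have c0E : fgn_sum_coef a 0 = 1 by rewrite /fgn_sum_coef big_ord0.
have coefD m : fgn_sum_coef a m.+1 = fgn_sum_coef a m + fgn_coef a m.+1.
  by rewrite -!fgn_sum_coefE// [in LHS]big_ord_recr.
elim: n => [|n IHn].
  by rewrite !big_ord1 subnn fgn_coef0// /fgn_sum_coef big_ord0.
rewrite [LHS]big_ord_recr/= IHn [X in _ + X = _]big_ord_recr/= subnn addrA -big_split/=.
rewrite [RHS]big_ord_recr/= subnn fgn_coef0// c0E.
congr (_ + _); apply: eq_bigr => j _.
have jn : (j <= n)%N by rewrite -ltnS.
by rewrite (subSn jn) coefD mulrDl.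
Qed.

End coefficients.

(** * Equidistribution modulo 1 of moving averages of the noise *)

Section equidistribution_of_sums.
Context (d : measure_display) (T : measurableType d) (R : realType)
  (P : probability T R) (W : nat -> {RV P >-> R}).
Hypothesis gW : gaussian_white_noise P W.

(** The variance coming from the noise after time m dominates [dl] times a harmonic sum, hence
    diverges. The offset [ka] may vary with n because the estimate is uniform in it. *)
Lemma cvg_prob_frac_ge (c ka : nat -> R) (dl th : R) m (B : set T) :
  (forall n, 0 < c n) -> 0 < dl -> (forall n, dl / n.+1%:R <= c n ^+ 2) ->
  past W m B -> 0 <= th <= 1 ->
  fine (P (B `&` [set w |
    th <= frac (\sum_(j < n.+1) c (n - j)%N * W j w + ka n)])) @[n --> \oo] -->
  (1 - th) * fine (P B).
Proof.
move=> c0 dl0 c_ge pB th01; apply/cvgrPdist_le => /= e e0.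
have ln0 : 0 < ln (1 + e ^+ 2) by rewrite ln_gt0// ltrDl exprn_gt0.
have hy : series (@harmonic R) n @[n --> \oo] --> +oo.
  apply: nondecreasing_dvgn_lt; last exact: dvg_harmonic.
  by apply/nondecreasing_seqP => n; rewrite !seriesEnat/= big_nat_recr//= lerDl.
(* Chosen so that the variance v satisfies 1 / v <= ln (1 + e^2): the chi-square term is then at
   most e^2 / (2 e), and the two halves add up to e. *)
have /cvgryPge /(_ (dl^-1 * (ln (1 + e ^+ 2))^-1)) [N _ hN] := hy.
exists (m + N)%N => //= n mNn.
have mn : (m <= n)%N by exact: leq_trans (leq_addr _ _) mNn.
pose a j := c (n - j)%N.
have a0 j : 0 < a j by exact: c0.
pose Y w := \sum_(j < m) a j * W j w.
have mY : measurable_fun setT (Y : g_sigma_algebraType (past_rect W m) -> R).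
  exact: past_measurable_sum.
have SE w : \sum_(j < n.+1) c (n - j)%N * W j w =
    Y w + \sum_(m <= j < (m + (n - m)).+1) a j * W j w.
  rewrite subnKC// -(big_mkord xpredT (fun j => c (n - j)%N * W j w)).
  by rewrite (@big_cat_nat _ _ _ m)//= ?leqW// big_mkord.
rewrite distrC.
rewrite (_ : [set w | _] = [set w | th <=
    frac (Y w + \sum_(m <= j < (m + (n - m)).+1) a j * W j w + ka n)]); last first.
  by apply/seteqP; split => w /=; rewrite SE.
apply: (le_trans (prob_frac_ge_past gW _ _ a0 pB mY th01 e0)).
set v := (\sum_(m <= j < _) _).
have v_ge : (ln (1 + e ^+ 2))^-1 <= v.
  have := hN (n - m).+1 (leqW _); rewrite /= ler_pdivrMl//.
  rewrite leq_subRL// => /(_ mNn)/le_trans; apply.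
  have -> : v = \sum_(0 <= j < n.+1 - m) a (j + m)%N ^+ 2.
    by rewrite /v subnKC// -{1}[m]add0n big_addn.
  rewrite seriesEnat/= big_mkord mulr_sumr subSn// big_mkord.
  (* Reversed in time, the weights of W_m, ..., W_n are c_0, ..., c_(n-m), matched with the harmonic
     terms one by one. *)
  rewrite [leRHS](reindex_inj rev_ord_inj)/=.
  apply: ler_sum => j _; rewrite /a subSS.
  rewrite (_ : (n - (n - m - j + m) = j)%N); last by have := ltn_ord j; lia.
  exact: c_ge.
have v0 : 0 < v by rewrite (lt_le_trans _ v_ge)// invr_gt0.
have ev : expR v^-1 <= 1 + e ^+ 2.
  rewrite -[leRHS]lnK ?posrE ?ltr_wpDr ?sqr_ge0// ler_expR.
  by rewrite invf_ple ?posrE.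
have : (expR v^-1 - 1) / (2 * e) <= e / 2.
  by rewrite ler_pdivrMr ?mulr_gt0//; lra.
by lra.
Qed.

End equidistribution_of_sums.

(** * The uniform distribution function *)

Section quantization.
Context (R : realType).

(** The noise is at most x when the fractional part is at least 1/2 - x. Since fractional parts lie
    in [0, 1[, clamping this threshold to [0, 1] leaves the event unchanged and treats all x at
    once. *)
Definition clamp01 (x : R) : R := Num.min (Num.max x 0) 1.

Lemma clamp01_itv (x : R) : 0 <= clamp01 x <= 1.
Proof. by rewrite /clamp01 le_min ge_min le_max !lexx ler01 orbT/= orbT. Qed.

Lemma clamp01_le_frac (x y : R) : (clamp01 x <= frac y) = (x <= frac y).
Proof.
have /andP[f0 f1] := frac_itv y.
by rewrite /clamp01 ge_min ge_max f0 andbT [X in _ || X]leNgt f1 orbF.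
Qed.

Lemma uniform_probNy (x : R) :
  uniform_prob (@ltN_half R) [set` `]-oo, x]] = (1 - clamp01 (2^-1 - x))%:E.
Proof.
rewrite /uniform_prob integral_uniform_pdf.
under eq_integral.
  move=> y; rewrite inE/= !in_itv/= => -[_ yI]; rewrite /uniform_pdf yI.
  rewrite opprK (_ : 2^-1 + 2^-1 = 1); last by lra.
  rewrite invr1; over.
rewrite integral_cst/=; last exact: measurableI.
rewrite mul1e /clamp01.
have [x1|x1] := ltP x (- 2^-1).
  rewrite (_ : _ `&` _ = set0) ?measure0.
    by rewrite (max_idPl _) ?(min_idPr _) ?subrr//; lra.
  by apply/seteqP; split => y //= []; rewrite !in_itv/=; lra.
have [x2|x2] := ltP x 2^-1.
  rewrite (_ : _ `&` _ = `[- 2^-1, x]%classic).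
    rewrite (max_idPl _) ?(min_idPl _); [|by lra..].
    rewrite lebesgue_measure_itv/= lte_fin; case: ifPn => ?.
      by rewrite -EFinB; congr EFin; lra.
    by congr EFin; lra.
  by apply/seteqP; split => y /=; rewrite !in_itv/=; lra.
rewrite (_ : _ `&` _ = `[- 2^-1, 2^-1]%classic).
  rewrite (max_idPr _) ?(min_idPl _)//; last by lra.
  rewrite lebesgue_measure_itv/= lte_fin ltN_half -EFinB; congr EFin; lra.
by apply/seteqP; split => y /=; rewrite !in_itv/=; lra.
Qed.

End quantization.

(** * The quantization noise of fractional Gaussian noise *)

Section quantization_noise.
Context (d : measure_display) (T : measurableType d) (R : realType)
  (P : probability T R) (H : R) (W : nat -> {RV P >-> R}).
Hypotheses (H01 : 0 < H < 1) (gW : gaussian_white_noise P W).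
Let WH : nat -> {RV P >-> R} := fun n => fgn H W n.

(** The signal at time i involves only W_0, ..., W_i, so the horizon t is decided by the past at
    time t + 1. *)
Lemma past_bounded_on_horizon b t : past W t.+1 (bounded_on_horizon b t WH).
Proof.
pose pT : measurableType _ := g_sigma_algebraType (past_rect W t.+1).
rewrite (_ : bounded_on_horizon b t WH =
    \bigcap_(i in [set i | (i <= t)%N]) (WH i @^-1` `[- b, b])).
  apply: (@bigcap_measurable _ pT); first by exists 0%N.
  move=> i /= it; have mWi j : (j <= i)%N -> measurable_fun setT (W j : pT -> R).
    by move=> ji; apply: past_measurable_noise; rewrite ltnS (leq_trans ji).
  have mfgn : measurable_fun setT (fgn H W i : pT -> R).
    rewrite /fgn; case: (H == 2^-1); first exact: mWi.
    apply: measurable_sum => j; apply: measurable_funM => //.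
    by apply: mWi; rewrite -ltnS.
  by rewrite -[X in measurable X]setTI; exact: mfgn.
apply/seteqP; split => w hw i it; have := hw i it; by rewrite /= in_itv.
Qed.

(** A general event [B] of the past serves both the unconditional law and the conditional one. The
    offset (n + 1) / 2 collects the halves added at each time. *)
Lemma cvg_prob_quantization_noise (Delta x : R) m B : 0 < Delta -> past W m B ->
  fine (P (B `&` quantization_noise Delta WH n @^-1` `]-oo, x])) @[n --> \oo] -->
  (1 - clamp01 (2^-1 - x)) * fine (P B).
Proof.
move=> D0 pB; pose c k := fgn_sum_coef (H - 2^-1) k / Delta.
have /andP[H0 H1] := H01.
have Hlt : - 2^-1 < H - 2^-1 by lra.
have c0 k : 0 < c k by rewrite divr_gt0// fgn_sum_coef_gt0//; lra.
have c_ge k : (4 * Delta ^+ 2)^-1 / k.+1%:R <= c k ^+ 2.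
  rewrite /c expr_div_n ler_pdivlMr ?exprn_gt0//.
  apply: le_trans (fgn_sum_coef_sqr_ge k Hlt).
  by rewrite le_eqVlt; apply/orP; left; apply/eqP; field; rewrite nat1r pnatr_eq0/= gt_eqF.
have dl0 : 0 < (4 * Delta ^+ 2)^-1 by rewrite invr_gt0 mulr_gt0// exprn_gt0.
have := cvg_prob_frac_ge gW (fun n => n.+1%:R / 2) c0 dl0 c_ge pB
  (clamp01_itv (2^-1 - x)).
apply: cvg_trans; apply: near_eq_cvg; near=> n.
congr (fine (P (_ `&` _))); apply/seteqP.
have SE w : \sum_(i < n.+1) (WH i w / Delta + 2^-1) =
    \sum_(j < n.+1) c (n - j)%N * W j w + n.+1%:R / 2.
  rewrite big_split/= sumr_const card_ord -[X in _ + X]mulr_natl; congr (_ + _).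
  rewrite -mulr_suml sum_fgn// mulr_suml; apply: eq_bigr => j _.
  by rewrite mulrAC.
have E w : (quantization_noise Delta WH n w <= x) =
    (clamp01 (2^-1 - x) <=
     frac (\sum_(j < n.+1) c (n - j)%N * W j w + n.+1%:R / 2)).
  by rewrite clamp01_le_frac -SE /quantization_noise lerBlDl lerBlDr.
by split => w /=; rewrite in_itv/= E.
Unshelve. all: end_near. Qed.

End quantization_noise.

Theorem theorem1 (R : realType) (d : measure_display) (T : measurableType d)
    (P : probability T R) (H : R) (W : nat -> {RV P >-> R})
    (b : R) (M t : nat) :
  0 < H < 1 ->
  gaussian_white_noise P W ->
  0 < b -> (1 < M)%N ->
  let WH : nat -> {RV P >-> R} := fun n => fgn H W n in
  let Delta := 2 * b / (M%:R - 1) in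
  let e : nat -> {RV P >-> R} := fun n => quantization_noise Delta WH n in
  let PB := conditional P (measurable_bounded_on_horizon b t WH) in
  cvg_in_distribution P e (uniform_prob (@ltN_half R)) /\
  cvg_in_distribution PB e (uniform_prob (@ltN_half R)).
Proof.
move=> H01 gW b0 M1 WH Delta e PB.
have D0 : 0 < Delta by rewrite divr_gt0 ?mulr_gt0// subr_gt0 ltr1n.
have cvgP : cvg_in_distribution P e (uniform_prob (@ltN_half R)).
  move=> x _; rewrite [X in _ --> X](uniform_probNy x).
  (* The unconditional law is the case of the sure event and the empty past. *)
  have pT : past W 0 setT by exact: (@measurableT _ (g_sigma_algebraType _)).
  have := cvg_prob_quantization_noise (x := x) H01 gW D0 pT.
  rewrite probability_setT mulr1 => h.
  rewrite (_ : (fun n => cdf (e n) x) = (fun n =>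
      (fine (P (setT `&` e n @^-1` `]-oo, x])))%:E)).
    by apply: cvg_EFin => //; near=> n.
  apply/funext => n; rewrite setTI fineK ?fin_num_measure//.
  by rewrite -[X in measurable X]setTI; exact: measurable_funP.
split=> // x cx; set B := bounded_on_horizon b t WH.
have pB : past W t.+1 B by exact: past_bounded_on_horizon.
have mB : measurable B by exact: past_measurable pB.
have meS n : measurable (e n @^-1` `]-oo, x]).
  by rewrite -[X in measurable X]setTI; exact: measurable_funP.
(* On a null event [mnormalize] returns its default [P], and the claim is the unconditional one. *)
have [PB0|PB0] := eqVneq (P B) 0%E.
  rewrite (_ : (fun n => @cdf _ _ _ PB (e n) x) = (fun n => P (e n @^-1` `]-oo, x]))).
    exact: cvgP cx.
  apply/funext => n; rewrite /cdf /distribution /pushforward /PB /conditional.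
  by rewrite /= /mnormalize /= /mrestr setTI PB0 eqxx.
have fPB0 : fine (P B) != 0 by rewrite fine_eq0 ?fin_num_measure.
have := cvg_prob_quantization_noise (x := x) H01 gW D0 pB.
move=> /cvgM /(_ (cvg_cst (fine (P B))^-1)); rewrite mulfK// => h.
rewrite [X in _ --> X](uniform_probNy x) (_ : (fun n => @cdf _ _ _ PB (e n) x) = (fun n =>
    (fine (P (B `&` e n @^-1` `]-oo, x])) / fine (P B))%:E)).
  by apply: cvg_EFin => //; near=> n.
apply/funext => n; rewrite /cdf /distribution /pushforward /PB /conditional.
rewrite /= /mnormalize /= /mrestr setTI (negbTE PB0)/=.
rewrite (_ : (P B == +oo%E) = false); last first.
  apply/eqP => PBy; have : P B \is a fin_num by exact: fin_num_measure.
  by rewrite PBy.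
rewrite EFinM fineK; last first.
  apply: fin_num_measure; apply: measurableI; [exact: mB|exact: meS].
by rewrite setIC.
Unshelve. all: end_near. Qed.
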